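(* Let $(A,\Pi)$ be an oriented Lie algebroid over $M$ with a Nambu structure of order $n$, and let $\mathcal A=(\Gamma(\wedge^{n-1}A^* ),[\cdot,\cdot])$ be the associated Leibniz algebra. For a nowhere vanishing $\mu\in\Gamma(\wedge^{\mathrm{top}}A^* )$ let $[M^\mu]\in\mathcal H^1_{Leib}(\mathcal A)$ be the class of the $1$-cocycle $\alpha\mapsto\iota_\alpha M^\mu$ given by the modular tensor field $M^\mu$. Then the cohomology class $[M^\mu]$ does not depend on the chosen nowhere vanishing section $\mu\in\Gamma(\wedge^{\mathrm{top}}A^* )$.
   Context: $\rho$ is the anchor of $A$, $d_A$ the Lie algebroid differential. For $X\in\Gamma A$: $\mathcal L_X=\iota_Xd_A+d_A\iota_X$ on forms; $\mathcal L_XP=[X,P]$ (Schouten bracket) on multisections. Contractions: multisections are evaluated by $P(\alpha_1\wedge\cdots\wedge\alpha_k)=P(\alpha_1,\dots,\alpha_k)$, with $(X_1\wedge\cdots\wedge X_k)(\alpha_1,\dots,\alpha_k)=\det(\alpha_i(X_j))$; for $\alpha\in\Gamma A^*$, $(\iota_\alpha P)(\beta)=P(\alpha\wedge\beta)$ and $\iota_{\alpha_1\wedge\cdots\wedge\alpha_k}=\iota_{\alpha_k}\circ\cdots\circ\iota_{\alpha_1}$, extended linearly. $\Pi^\sharp\alpha=\iota_\alpha\Pi$. Nambu structure of order $n$ ($3\le n\le\operatorname{rank}A$): $\Pi\in\Gamma(\wedge^nA)$ with $\mathcal L_{\Pi^\sharp\alpha}\Pi=(-1)^n(\iota_{d_A\alpha}\Pi)\Pi$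 for all $\alpha\in\Gamma(\wedge^{n-1}A^* )$. The (left) Leibniz algebra $\mathcal A$: $\Gamma(\wedge^{n-1}A^* )$ with $[\alpha,\beta]=\mathcal L_{\Pi^\sharp\alpha}\beta+(-1)^n(\iota_{d_A\alpha}\Pi)\beta$, acting on $C^\infty(M)$ by $(\alpha,f)\mapsto\rho(\Pi^\sharp\alpha)(f)$. $\mathcal H^1_{Leib}(\mathcal A)$ is the quotient of the space of $1$-cocycles, i.e. $\mathbb R$-linear maps $c:\Gamma(\wedge^{n-1}A^* )\to C^\infty(M)$ with $\rho(\Pi^\sharp\alpha)(c(\beta))-\rho(\Pi^\sharp\beta)(c(\alpha))=c([\alpha,\beta])$, by the space of coboundaries $d_{\mathcal A}f:\alpha\mapsto\rho(\Pi^\sharp\alpha)(f)$, $f\in C^\infty(M)$. Modular tensor field: $M^\mu\in\Gamma(\wedge^{n-1}A)$ is defined by $(\iota_\alpha M^\mu)\mu=\mathcal L_{\Pi^\sharp\alpha}\mu+(-1)^n(\iota_{d_A\alpha}\Pi)\mu$ for all $\alpha\in\Gamma(\wedge^{n-1}A^* )$; the map $\alpha\mapsto\iota_\alpha M^\mu$ is a $1$-cocycle. *)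

(* Defs.v *)
From HB Require Import structures.
From mathcomp Require Import all_boot all_order all_algebra.
From mathcomp Require Import all_classical all_reals all_analysis.

Set Implicit Arguments.
Unset Strict Implicit.
Unset Printing Implicit Defensive.

Import Order.TTheory GRing.Theory Num.Theory.
Import numFieldNormedType.Exports.

Local Open Scope classical_set_scope.
Local Open Scope ring_scope.

Section SmoothEuclidean.
Context {R : realType} {m : nat}.
Implicit Types (U : set 'rV[R]_m) (f : 'rV[R]_m -> R).

(* Used for open U only; f may take arbitrary values outside U. *)
Fixpoint Ck (k : nat) U f : Prop :=
  if k is k'.+1 then
    (forall x, U x -> differentiable f x) /\
    (forall v : 'rV[R]_m, Ck k' U (fun x => 'D_v f x))
  else forall x, U x -> {for x, continuous f}.

Definition Cinfty U f : Prop := forall k, Ck k U f.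

End SmoothEuclidean.

(* A smooth m-manifold, given by an atlas indexed by chart_idx. The map
   chart_inv i is only meaningful on the image of chart i. *)
Record manifold (R : realType) (m : nat) := Manifold {
  mpoint :> topologicalType;
  manifold_hausdorff : hausdorff_space mpoint;
  manifold_second_countable : @second_countable mpoint;
  chart_idx : Type;
  chart_dom : chart_idx -> set mpoint;
  chart : chart_idx -> mpoint -> 'rV[R]_m;
  chart_inv : chart_idx -> 'rV[R]_m -> mpoint;
  chart_dom_open : forall i, open (chart_dom i);
  chart_img_open : forall i, open (chart i @` chart_dom i);
  chart_cover : forall p, exists i, chart_dom i p;
  chartK : forall i p, chart_dom i p -> chart_inv i (chart i p) = p;
  chart_continuous : forall i p, chart_dom i p ->
    {for p, continuous (chart i)};
  chart_inv_continuous : forall i x, (chart i @` chart_dom i) x ->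
    {for x, continuous (chart_inv i)};
  chart_transition : forall i j (l : 'I_m),
    Cinfty (chart i @` (chart_dom i `&` chart_dom j))
           (fun x => chart j (chart_inv i x) 0 l)
}.

Section SmoothFunctions.
Context {R : realType} {m : nat} {M : manifold R m}.

Definition smooth_on (W : set M) (f : M -> R) : Prop :=
  forall i : chart_idx M,
    Cinfty (chart i @` (chart_dom i `&` W)) (fun x => f (chart_inv i x)).

Definition smooth (f : M -> R) : Prop := smooth_on setT f.

(* T_p M is the space of derivations at p of the algebra of smooth functions. *)
Definition tangent_vector (p : M) (D : (M -> R) -> R) : Prop :=
  (forall (a : R) f g, smooth f -> smooth g ->
     D (fun q => a * f q + g q) = a * D f + D g) /\
  (forall f g, smooth f -> smooth g ->
     D (fun q => f q * g q) = f p * D g + g p * D f).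

End SmoothFunctions.

(* A smooth vector bundle of rank r, given by its fibres and a covering family
   of local frames with smooth transition functions. *)
Record vbundle (R : realType) (m : nat) (M : manifold R m) (r : nat) :=
  VBundle {
  fibre :> M -> vectType R;
  frame_idx : Type;
  frame_dom : frame_idx -> set M;
  frame : frame_idx -> forall p : M, r.-tuple (fibre p);
  frame_dom_open : forall j, open (frame_dom j);
  frame_cover : forall p, exists j, frame_dom j p;
  frame_basis : forall j p, frame_dom j p -> basis_of fullv (frame j p);
  frame_transition : forall j k (a b : 'I_r),
    smooth_on (frame_dom j `&` frame_dom k)
              (fun p => coord (frame k p) b (tnth (frame j p) a))
}.

Section ExteriorAlgebra.
Context {R : realType}.

Definition dual (V : vectType R) : vectType R := 'Hom(V, R^o).

(* An alternating k-linear form on V, as a function on lists of vectors which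
   is zero on lists of length other than k. *)
Definition alternating (V : vectType R) (k : nat) (f : seq V -> R) : Prop :=
  [/\ forall s, size s <> k -> f s = 0,
      forall (a : R) x y s1 s2,
        f (s1 ++ (a *: x + y) :: s2)
          = a * f (s1 ++ x :: s2) + f (s1 ++ y :: s2)
    & forall s, ~~ uniq s -> f s = 0].

Section Fibre.
Variable V : vectType R.

Definition basis_vec (i : 'I_(\dim {:V})) : V := (vbasis {:V})`_i.
Definition basis_covec (i : 'I_(\dim {:V})) : dual V :=
  linfun (coord (vbasis {:V}) i : V -> R^o).

(* (iota_a P)(bs). With e_i the chosen basis of V and e^i its dual basis,
   a = \sum_I a(e_I) e^I over the increasing multi-indices I, and
   (iota_(e^I) P)(bs) = P(e^I, bs). An a of degree j is zero on e_I unless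
   #|I| = j, so the sum may run over all I. *)
Definition contract (a : seq V -> R) (P : seq (dual V) -> R)
    (bs : seq (dual V)) : R :=
  \sum_(I : {set 'I_(\dim {:V})})
     a [seq basis_vec i | i <- enum I]
     * P ([seq basis_covec i | i <- enum I] ++ bs).

(* An alternating form of degree 1 on the dual of V, as a vector of V. *)
Definition vec_of_bidual (P : seq (dual V) -> R) : V :=
  \sum_i P [:: basis_covec i] *: basis_vec i.

(* (x_1 ^ ... ^ x_k)(b_1, ..., b_k) = det (b_i (x_j)) *)
Definition wedge (xs : seq V) (bs : seq (dual V)) : R :=
  if size bs == size xs then
    \det (\matrix_(i < size xs, j < size xs) (bs`_i) (xs`_j))
  else 0.

End Fibre.
End ExteriorAlgebra.

Section Sections.
Context {R : realType} {m : nat} {M : manifold R m} {r : nat}.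
Variable A : vbundle M r.

(* Not necessarily smooth sections of A, of the exterior algebra of its dual,
   and of its own exterior algebra. *)
Definition rsection := forall p : M, A p.
Definition rform := forall p : M, seq (A p) -> R.
Definition rmultisection := forall p : M, seq (dual (A p)) -> R.

Definition smooth_section (X : rsection) : Prop :=
  forall (j : frame_idx A) (b : 'I_r),
    smooth_on (frame_dom j) (fun p => coord (frame j p) b (X p)).

Definition smooth_form (k : nat) (alpha : rform) : Prop :=
  (forall p, alternating k (alpha p)) /\
  (forall (j : frame_idx A) (I : k.-tuple 'I_r),
    smooth_on (frame_dom j)
      (fun p => alpha p [seq tnth (frame j p) i | i <- I])).

Definition coframe (j : frame_idx A) (p : M) (i : 'I_r) : dual (A p) :=
  linfun (coord (frame j p) i : A p -> R^o).

Definition smooth_multisection (k : nat) (P : rmultisection) : Prop :=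
  (forall p, alternating k (P p)) /\
  (forall (j : frame_idx A) (I : k.-tuple 'I_r),
    smooth_on (frame_dom j) (fun p => P p [seq coframe j p i | i <- I])).

Definition nowhere_vanishing (mu : rform) : Prop :=
  forall p, exists s, mu p s != 0.

Definition orientable : Prop :=
  exists omega, smooth_form r omega /\ nowhere_vanishing omega.

(* Some smooth section with value v at p. *)
Definition extend (p : M) (v : A p) : rsection :=
  match pselect (exists X : rsection, smooth_section X /\ X p = v) with
  | left h => projT1 (cid h)
  | right _ => fun=> 0
  end.

Definition eval_at (p : M) (Xs : seq rsection) : seq (A p) :=
  [seq (X : rsection) p | X <- Xs].

End Sections.

(* The bracket is constrained on smooth sections, the anchor on smooth
   functions. That the anchor preserves brackets follows from the axioms. *)
Record lie_algebroid (R : realType) (m : nat) (M : manifold R m) (r : nat) :=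
  LieAlgebroid {
  bundle :> vbundle M r;
  anchor : forall p : M, bundle p -> (M -> R) -> R;
  bracket : rsection bundle -> rsection bundle -> rsection bundle;
  anchor_tangent : forall p (v : bundle p), tangent_vector p (anchor v);
  anchor_linear : forall p (a : R) (v w : bundle p) (f : M -> R), smooth f ->
    anchor (a *: v + w) f = a * anchor v f + anchor w f;
  anchor_smooth : forall (X : rsection bundle) (f : M -> R),
    smooth_section X -> smooth f -> smooth (fun p => anchor (X p) f);
  bracket_smooth : forall X Y, smooth_section X -> smooth_section Y ->
    smooth_section (bracket X Y);
  bracket_linear : forall (a : R) X Y Z,
    smooth_section X -> smooth_section Y -> smooth_section Z ->
    forall p, bracket (fun q => a *: X q + Y q) Z p
              = a *: bracket X Z p + bracket Y Z p;
  bracket_antisym : forall X Y, smooth_section X -> smooth_section Y ->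
    forall p, bracket X Y p = - bracket Y X p;
  bracket_jacobi : forall X Y Z,
    smooth_section X -> smooth_section Y -> smooth_section Z ->
    forall p, bracket X (bracket Y Z) p + bracket Y (bracket Z X) p
              + bracket Z (bracket X Y) p = 0;
  bracket_leibniz : forall X Y (f : M -> R),
    smooth_section X -> smooth_section Y -> smooth f ->
    forall p, bracket X (fun q => f q *: Y q) p
              = f p *: bracket X Y p + anchor (X p) f *: Y p
}.

Section Calculus.
Context {R : realType} {m : nat} {M : manifold R m} {r : nat}.
Variable A : lie_algebroid M r.

Definition del (T : Type) (i : nat) (s : seq T) : seq T :=
  take i s ++ drop i.+1 s.

(* (d_A alpha)(X_0, ..., X_k) =
     \sum_i (-1)^i rho(X_i)(alpha(.., ^X_i, ..))
     + \sum_(i < j) (-1)^(i+j) alpha([X_i, X_j], .., ^X_i, .., ^X_j, ..) *)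
Definition koszul (alpha : rform A) (Xs : seq (rsection A)) (p : M) : R :=
  let X i : rsection A := nth (fun=> 0) Xs i in
  \sum_(i < size Xs)
     (-1) ^+ i * anchor (X i p) (fun q => alpha q (eval_at q (del i Xs)))
  + \sum_(j < size Xs) \sum_(i < size Xs | (i < j)%N)
     (-1) ^+ (i + j)
     * alpha p (bracket (X i) (X j) p :: eval_at p (del i (del j Xs))).

(* For smooth alpha the Koszul formula is tensorial, so the value at p does not
   depend on the sections extending the given vectors. *)
Definition dA (alpha : rform A) : rform A :=
  fun p vs => koszul alpha [seq extend v | v <- vs] p.

Definition iota (X : rsection A) (alpha : rform A) : rform A :=
  fun p vs => alpha p (X p :: vs).

Definition lieD (X : rsection A) (alpha : rform A) : rform A :=
  fun p vs => iota X (dA alpha) vs + dA (iota X alpha) vs.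

(* Q = [X, P] (Schouten bracket) for P of degree k > 0: P is a finite sum of
   Y_1 ^ ... ^ Y_k, and Q is the corresponding sum of the
   \sum_i Y_1 ^ ... ^ [X, Y_i] ^ ... ^ Y_k. *)
Definition is_schouten (k : nat) (X : rsection A) (P Q : rmultisection A) :
    Prop :=
  exists (N : nat) (Y : 'I_N -> 'I_k -> rsection A),
    [/\ forall a i, smooth_section (Y a i),
        forall p bs, P p bs
          = \sum_(a < N) wedge [seq Y a i p | i <- enum 'I_k] bs
      & forall p bs, Q p bs
          = \sum_(a < N) \sum_(i < k)
              wedge [seq (if l == i then bracket X (Y a i) p else Y a l p)
                    | l <- enum 'I_k] bs].

Definition pairing (alpha : rform A) (P : rmultisection A) : M -> R :=
  fun p => contract (alpha p) (P p) [::].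

Definition sharp (Pi : rmultisection A) (alpha : rform A) : rsection A :=
  fun p => vec_of_bidual (contract (alpha p) (Pi p)).

Definition nambu (n : nat) (Pi : rmultisection A) : Prop :=
  [/\ (3 <= n <= r)%N,
      smooth_multisection n Pi
    & forall alpha, smooth_form n.-1 alpha ->
        is_schouten n (sharp Pi alpha) Pi
          (fun p bs => (-1) ^+ n * pairing (dA alpha) Pi p * Pi p bs)].

(* The Leibniz bracket [alpha, beta] of degree n - 1 forms. The same formula
   with a top form in place of beta defines the modular tensor field. *)
Definition leib (n : nat) (Pi : rmultisection A) (alpha beta : rform A) :
    rform A :=
  fun p vs => lieD (sharp Pi alpha) beta vs
              + (-1) ^+ n * pairing (dA alpha) Pi p * beta p vs.

Definition leib_action (Pi : rmultisection A) (alpha : rform A) (f : M -> R) :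
    M -> R :=
  fun p => anchor (sharp Pi alpha p) f.

Definition form (k : nat) := {alpha : rform A | smooth_form k alpha}.

Definition cochain (n : nat) := form n.-1 -> M -> R.

Definition cocycle (n : nat) (Pi : rmultisection A) (c : cochain n) : Prop :=
  [/\ forall alpha, smooth (c alpha),
      forall (a : R) (alpha beta gamma : form n.-1),
        (forall p vs, sval gamma p vs = a * sval alpha p vs + sval beta p vs) ->
        forall p, c gamma p = a * c alpha p + c beta p
    & forall alpha beta gamma : form n.-1,
        (forall p vs, sval gamma p vs = leib n Pi (sval alpha) (sval beta) vs) ->
        forall p, leib_action Pi (sval alpha) (c beta) p
                  - leib_action Pi (sval beta) (c alpha) p = c gamma p].

Definition coboundary {n : nat} (Pi : rmultisection A) (f : M -> R) :
    cochain n :=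
  fun alpha => leib_action Pi (sval alpha) f.

(* The class of a cocycle c in H^1_Leib, i.e. the set of cocycles which differ
   from c by a coboundary. *)
Definition leib_class (n : nat) (Pi : rmultisection A) (c : cochain n) :
    set (cochain n) :=
  [set z | cocycle Pi z /\
     exists2 f, smooth f &
       forall alpha p, z alpha p = c alpha p + coboundary Pi f alpha p].

Definition modular_tensor (n : nat) (Pi : rmultisection A) (mu : rform A)
    (T : rmultisection A) : Prop :=
  smooth_multisection n.-1 T /\
  forall alpha, smooth_form n.-1 alpha ->
    forall p vs, pairing alpha T p * mu p vs = leib n Pi alpha mu vs.

Definition contraction_cochain (n : nat) (T : rmultisection A) : cochain n :=
  fun alpha => pairing (sval alpha) T.

End Calculus.

Arguments contraction_cochain {R m M r A} n T alpha _.

(* Main.v *)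
(* Two volume forms differ by a nowhere vanishing smooth factor, mu' = g mu.
   The Lie derivative of a top form satisfies
     L_X (g mu) = g L_X mu + rho(X)(g) mu,
   so for X = Pi^# alpha the two cocycles differ by rho(X)(g) / g = rho(X)(ln |g|),
   the coboundary of ln |g|.

   As rho(X) is only an abstract derivation of the algebra of smooth functions,
   the last equality needs a Hadamard expansion of exp with smooth remainder.
   As d_A is defined through sections extending given vectors, the first one
   needs bump functions to produce those extensions. *)
From mathcomp Require Import all_boot all_order all_algebra.
From mathcomp Require Import all_classical all_reals all_analysis.
From mathcomp Require Import zify ring lra.
Require Import Defs.

Set Implicit Arguments.
Unset Strict Implicit.
Unset Printing Implicit Defensive.

Import Order.TTheory GRing.Theory Num.Theory.
Import numFieldNormedType.Exports.

Local Open Scope classical_set_scope.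
Local Open Scope ring_scope.

(** * Smooth functions on open subsets of Euclidean space *)

(** A less visible obstacle is the smoothness of [sharp Pi alpha]: the product rule for the Lie
    derivative evaluates forms on this section, and the anchor is a derivation on smooth functions
    only. Contraction is written in a basis of each fibre chosen point by point, hence with no
    smoothness. The way out is that a Schouten bracket comes with a decomposition of [Pi] into
    wedges of smooth sections; contraction with a wedge is a Laplace expansion, from which the basis
    drops out.

    For the logarithm, the expansion of exp is convenient because its remainder is an entire series.
    Applied to ln (g^2), the chain rule for exp concerns g^2, whose derivative the product rule
    gives; the equation is then solved for the derivative of ln (g^2). The square also covers both
    signs of g. *)

Section CkTheory.
Context {R : realType} {m : nat}.
Implicit Types (U V : set 'rV[R]_m) (f g : 'rV[R]_m -> R) (x : 'rV[R]_m).

Lemma near_differentiable f g x :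
  (\near x, f x = g x) -> differentiable f x -> differentiable g x.
Proof.
move=> fg df.
pose h := g - f.
have h0 : \forall y \near x, h y = 0.
  by apply: filterS fg => y fgy; rewrite /h !fctE fgy subrr.
have hs : h \o shift x = cst (h x) + (\0 : 'rV[R]_m -> R) +o_ (0 : 'rV[R]_m) id.
  apply/eqaddoP => _/posnumP[e]; rewrite (nbhs_singleton h0).
  have : \forall y \near (0 : 'rV[R]_m), h (y + x) = 0.
    by rewrite (near_shift x) sub0r; near=> y; rewrite /= subrK; near: y.
  apply: filterS => y hy.
  by rewrite !fctE /= hy addr0 subrr normr0.
have dh : 'd h x = \0 :> ('rV[R]_m -> R).
  by apply: diff_unique => //; exact: cst_continuous.
have -> : g = f + h by rewrite /h addrC subrK.
apply: differentiableD => //.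
apply/diff_locallyP; rewrite dh; split => //; exact: cst_continuous.
Unshelve. all: by end_near. Qed.

Lemma Ck_sub k U V f : U `<=` V -> Ck k V f -> Ck k U f.
Proof.
elim: k f => [|k IH] f UV /=; first by move=> h x /UV; exact: h.
by case=> h1 h2; split=> [x /UV|v]; [exact: h1|exact: IH].
Qed.

(** The derivatives in [Ck] are those of the ambient space, so on a singleton [Ck] is a condition on
    the germ of f there. Locality of smoothness rests on this. *)
Lemma Ck_pointwise k U f : (forall x, U x -> Ck k [set x] f) -> Ck k U f.
Proof.
elim: k f => [|k IH] f h /=; first by move=> x Ux; exact: (h x Ux x).
split=> [x Ux|v]; first by have [df _] := h x Ux; exact: df.
by apply: IH => x Ux; have [_ Df] := h x Ux; exact: Df.
Qed.

Lemma Ck_near k x f g : (\near x, f x = g x) -> Ck k [set x] f -> Ck k [set x] g.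
Proof.
elim: k f g => [|k IH] f g fg /=.
  move=> h _ ->; have := h x erefl.
  rewrite /prop_for /continuous_at (nbhs_singleton fg); apply: cvg_trans.
  exact: (@near_eq_cvg _ _ (nbhs x) _ f g fg).
case=> h1 h2; split=> [_ ->|v]; first exact: near_differentiable (h1 x erefl).
(* The induction needs the directional derivatives to agree near x, so f = g is required near every
   y close to x. *)
apply: IH (h2 v); move/nbhs_interior: fg; apply: filterS => y fg.
exact: near_eq_derive.
Qed.

Lemma Ck_eq k U f g : open U -> (forall x, U x -> f x = g x) ->
  Ck k U f -> Ck k U g.
Proof.
move=> oU fg cf; apply: Ck_pointwise => x Ux; apply: (@Ck_near _ _ f).
  by near=> y; apply: fg; near: y; exact: open_nbhs_nbhs.
by apply: Ck_sub cf => _ ->.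
Unshelve. all: by end_near. Qed.

Lemma Ck_continuous k U f x : Ck k U f -> U x -> {for x, continuous f}.
Proof.
case: k => [|k]; first exact.
by move=> [df _] Ux; exact/differentiable_continuous/df.
Qed.

Lemma CkS k U f : Ck k.+1 U f -> Ck k U f.
Proof.
elim: k f => [|k IH] f.
  by move=> cf x; exact: Ck_continuous cf.
by move=> [df Df]; split=> // v; exact: IH.
Qed.

Lemma Ck_cst k U (a : R) : Ck k U (cst a).
Proof.
elim: k a => [|k IH] a; first by move=> x _; exact: cst_continuous.
split=> [x _|v]; first exact: differentiable_cst.
by rewrite (_ : (fun x => _) = cst 0); [exact: IH|apply/funext => x; exact: derive_cst].
Qed.

Lemma CkD k U f g : open U -> Ck k U f -> Ck k U g -> Ck k U (f \+ g).
Proof.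
move=> oU; elim: k f g => [|k IH] f g.
  by move=> cf cg x Ux; apply: continuousD; [exact: cf|exact: cg].
move=> [df Df] [dg Dg]; split=> [x Ux|v].
  by apply: differentiableD; [exact: df|exact: dg].
apply: Ck_eq (IH _ _ (Df v) (Dg v)) => // x Ux.
by rewrite -[RHS]/('D_v (f + g) x) deriveD//; apply: diff_derivable; [exact: df|exact: dg].
Qed.

Lemma CkM k U f g : open U -> Ck k U f -> Ck k U g -> Ck k U (f \* g).
Proof.
move=> oU; elim: k f g => [|k IH] f g.
  by move=> cf cg x Ux; apply: continuousM; [exact: cf|exact: cg].
move=> cf cg; have [df Df] := cf; have [dg Dg] := cg; split=> [x Ux|v].
  by apply: differentiableM; [exact: df|exact: dg].
apply: Ck_eq (CkD oU (IH _ _ (CkS cf) (Dg v)) (IH _ _ (CkS cg) (Df v))) => // x Ux.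
by rewrite -[RHS]/('D_v (f * g) x) deriveM//; apply: diff_derivable; [exact: df|exact: dg].
Qed.

(* Smoothness of phi is encoded by a family F containing phi and stable under
   derivation, which spares the induction any formula for higher derivatives. *)
Lemma Ck_comp k (F : set (R -> R)) (O : set R) :
    (forall phi, F phi -> exists2 psi, F psi &
       forall t, O t -> is_derive t 1 phi (psi t)) ->
  forall phi U f, F phi -> open U -> (forall x, U x -> O (f x)) ->
    Ck k U f -> Ck k U (phi \o f).
Proof.
move=> FF; elim: k => [|k IH] phi U f Fphi oU Of; have [psi Fpsi dphi] := FF _ Fphi;
  have dphif x (Ux : U x) : differentiable phi (f x) by
    apply/derivable1_diffP; have [] := dphi _ (Of _ Ux).
  move=> cf x Ux; apply: continuous_comp; first exact: cf.
  exact/differentiable_continuous/dphif.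
move=> cf; have [df Df] := cf; split=> [x Ux|v].
  by apply: differentiable_comp; [exact: df|exact: dphif].
apply: Ck_eq (CkM oU (IH psi _ _ Fpsi oU Of (CkS cf)) (Df v)) => // x Ux.
rewrite deriveE; last by apply: differentiable_comp; [exact: df|exact: dphif].
rewrite diff_comp /=; [|exact: df|exact: dphif].
rewrite diff1E; last exact: dphif.
rewrite derive1E; have [_ ->] := dphi _ (Of _ Ux).
by rewrite -deriveE; [exact: mulrC|exact: df].
Qed.

End CkTheory.

(** * One-variable functions: exponential remainder, flat functions, polynomials in 1/t *)

Section OneVariable.
Context {R : realType}.
Implicit Types (c : nat -> R) (t : R) (p : {poly R}).

Lemma is_cvg_pseries_fact c t :
  (forall i, `|c i| <= i`!%:R^-1) -> cvgn (pseries c t).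
Proof.
move=> cb; apply: normed_cvg; rewrite /normed_series_of /=.
apply: (@series_le_cvg R _ (exp_coeff `|t|)) => [n|n|n|].
- exact: normr_ge0.
- exact: exp_coeff_ge0.
- by rewrite exp_coeffE normrM normrX ler_wpM2r.
- exact: is_cvg_series_exp_coeff.
Qed.

(** Since (i+1) / (i+1)! = 1 / i!, termwise derivation preserves the bound. Series with such
    coefficients thus form a family to which [Ck_comp] applies. *)
Lemma pseries_diffs_fact c :
  (forall i, `|c i| <= i`!%:R^-1) -> forall i, `|pseries_diffs c i| <= i`!%:R^-1.
Proof.
move=> cb i; have -> : i`!%:R^-1 = i.+1%:R * i.+1`!%:R^-1 :> R.
  by rewrite factS natrM invfM mulVKf.
by rewrite /pseries_diffs normrM normr_nat ler_wpM2l.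
Qed.

Lemma is_derive_pseries_fact c t : (forall i, `|c i| <= i`!%:R^-1) ->
  is_derive t (1 : R) (fun t => limn (pseries c t)) (limn (pseries (pseries_diffs c) t)).
Proof.
(* Termwise derivation at t asks for convergence at some point of larger modulus. *)
move=> cb; apply: (@pseries_snd_diffs _ _ (`|t| + 1)).
- exact: is_cvg_pseries_fact.
- exact/is_cvg_pseries_fact/pseries_diffs_fact.
- exact/is_cvg_pseries_fact/pseries_diffs_fact/pseries_diffs_fact.
- by rewrite [ltRHS]ger0_norm ?addr_ge0// ltrDl.
Qed.

(** This is (exp t - 1 - t) / t^2, given by its series so that it is smooth at 0 as well. *)
Definition expR_remainder t : R := limn (pseries (fun i => i.+2`!%:R^-1) t).

Lemma fact_remainder i : `|i.+2`!%:R^-1| <= i`!%:R^-1 :> R.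
Proof.
rewrite ger0_norm ?invr_ge0// lef_pV2 ?posrE ?ltr0n ?fact_gt0// ler_nat.
by rewrite !factS mulnA leq_pmull ?muln_gt0.
Qed.

Lemma expR_remainderE t : expR t = 1 + t + t ^+ 2 * expR_remainder t.
Proof.
rewrite /expR; apply: cvg_lim => //; rewrite -(cvg_shiftn 2).
have := @is_cvg_pseries_fact _ t fact_remainder; rewrite -/(expR_remainder t) => ct.
rewrite (_ : (fun n => _) = fun n => 1 + t + t ^+ 2 * pseries (fun i => i.+2`!%:R^-1) t n).
  by apply: cvgD; [exact: cvg_cst|apply: cvgM ct; exact: cvg_cst].
apply/funext => n; rewrite /series /pseries /= addn2 !big_mkord !big_ord_recl /=.
rewrite exp_coeffE /= expr0 expr1 fact0 factS fact0 mul1n invr1 !mul1r addrA.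
congr (_ + _); rewrite mulr_sumr big_mkord; apply: eq_bigr => i _.
by rewrite /bump !add1n -addn2 exprD; ring.
Qed.

(** For i > 0 and u = s / i one has u <= 1 + u <= exp u, hence s^i = i^i u^i <= i^i exp s. With 0^0
    = 1 the same constant serves for i = 0. *)
Lemma horner_expR_bounded p : exists C, forall s, 0 <= s -> `|p.[s]| <= C * expR s.
Proof.
exists (\sum_(i < size p) `|p`_i| * (i%:R) ^+ i) => s s0.
rewrite horner_coef (le_trans (ler_norm_sum _ _ _))// mulr_suml; apply: ler_sum => -[i _] _ /=.
rewrite normrM -mulrA ler_wpM2l// normrX ger0_norm//.
case: i => [|i]; first by rewrite !expr0 mul1r -expR0 ler_expR.
pose u := s / i.+1%:R; have u0 : 0 <= u by rewrite divr_ge0.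
have -> : s = i.+1%:R * u by rewrite mulrC divfK.
rewrite expRM_natl -exprMn lerXn2r ?nnegrE ?mulr_ge0 ?expR_ge0// ler_wpM2l//.
by rewrite (le_trans _ (expR_ge1Dx _))// lerDr.
Qed.

(* p(1/t) exp(-1/t) for t > 0; these functions are flat at 0, and the family is
   stable under derivation. *)
Definition flat p t : R := if 0 < t then p.[t^-1] * expR (- t^-1) else 0.

Lemma is_derive_quadratic_bound (f : R -> R) C :
  (forall t, `|f t| <= C * t ^+ 2) -> is_derive (0 : R) (1 : R) f 0.
Proof.
move=> fC; have f0 : f 0 = 0.
  by apply/eqP; rewrite -normr_le0 (le_trans (fC 0))// expr0n mulr0.
have C0 : 0 <= C by have := fC 1; rewrite expr1n mulr1; apply: le_trans.
suff h0 : (h^-1 *: ((f \o shift 0) (h *: 1) - f 0)) @[h --> (0 : R)^'] --> (0 : R).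
  by split; [apply/cvg_ex; exists 0|exact: cvg_lim].
apply/cvgr0Pnorm_lt => e e0; near=> h.
have h0 : h != 0 by near: h; exact: nbhs_dnbhs_neq.
rewrite /= f0 subr0 addr0 [h *: 1]mulr1 normrZ normfV ltr_pdivrMl ?normr_gt0//.
rewrite (le_lt_trans (fC h))// -real_normK ?num_real// expr2 mulrCA ltr_pM2l ?normr_gt0//.
apply: (@le_lt_trans _ _ ((C + 1) * `|h|)); first by rewrite ler_wpM2r// lerDl.
rewrite mulrC -ltr_pdivlMr ?ltr_wpDl//; near: h.
apply: dnbhs0_lt; rewrite divr_gt0// ltr_wpDl//.
Unshelve. all: by end_near. Qed.

Lemma is_derive_flat p t :
  is_derive t (1 : R) (flat p) (flat ('X^2 * (p - p^`())) t).
Proof.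
have [t0|t0|->] := ltrgtP t 0.
- rewrite /flat ltNge (ltW t0) /=.
  apply: (@near_eq_is_derive _ _ _ (cst 0)).
  by near=> s; rewrite /flat ltNge ltW//; near: s; exact: lt_nbhsl.
- have -> : flat ('X^2 * (p - p^`())) t
      = (p.[t^-1] * (expR (- t^-1) * t^-2)) + expR (- t^-1) * (p^`().[t^-1] * - t^-2).
    by rewrite /flat t0 hornerM hornerXn hornerD hornerN exprVn; ring.
  have dV : is_derive t (1 : R) (fun t => t^-1) (- t^-2).
    apply: is_derive_eq; first by apply: is_deriveV; rewrite gt_eqF.
    by rewrite [_ *: 1]mulr1.
  have dN : is_derive t (1 : R) (fun t => - t^-1) (t^-2).
    by apply: is_derive_eq; rewrite opprK.
  apply: (@near_eq_is_derive _ _ _ ((horner p \o (fun t => t^-1)) * (expR \o (fun t => - t^-1)))).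
    by near=> s; rewrite /flat ifT//; near: s; exact: lt_nbhsr.
  apply: is_deriveM.
(* At s = 1/t the bound for X^2 p reads |flat p t| <= C t^2, which forces a zero derivative at 0.
   The absolute value of C makes the bound valid for t <= 0 too. *)
- have [C Cp] := horner_expR_bounded ('X^2 * p).
  rewrite {2}/flat ltxx; apply: (@is_derive_quadratic_bound _ `|C|) => s.
  rewrite /flat; case: ifPn => [s0|_]; last by rewrite normr0 mulr_ge0// sqr_ge0.
  have := Cp s^-1 (ltW _); rewrite invr_gt0 => /(_ s0).
  rewrite hornerM hornerXn exprVn normrM normfV [`|s ^+ 2|]ger0_norm ?sqr_ge0//.
  rewrite ler_pdivrMl ?exprn_gt0//.
  move=> h; rewrite normrM [`|expR _|]ger0_norm ?expR_ge0// expRN ler_pdivrMr ?expR_gt0//.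
  rewrite (le_trans h)// mulrCA -[leRHS]mulrA ler_wpM2r ?ler_norm//.
  by rewrite mulr_ge0 ?sqr_ge0 ?expR_ge0.
Unshelve. all: by end_near. Qed.

Lemma is_derive_hornerV p t : t != 0 ->
  is_derive t (1 : R) (fun t => p.[t^-1]) (- 'X^2 * p^`()).[t^-1].
Proof.
move=> t0; have dV : is_derive t (1 : R) (fun t => t^-1) (- t^-2).
  by apply: is_derive_eq; [exact: is_deriveV|rewrite [_ *: 1]mulr1].
have : is_derive t (1 : R) (horner p \o (fun t => t^-1)) (p^`().[t^-1] * - t^-2).
  exact: is_derive1_comp.
by congr is_derive; rewrite hornerM hornerN hornerXn exprVn; ring.
Qed.

End OneVariable.

(** * Smooth composites *)

Section SmoothComposition.
Context {R : realType} {m : nat}.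
Implicit Types (U : set 'rV[R]_m) (f : 'rV[R]_m -> R).

Lemma Cinfty_flat U f : open U -> Cinfty U f -> Cinfty U (flat 1 \o f).
Proof.
move=> oU cf k; apply: (@Ck_comp _ _ _ [set phi | exists p, phi = flat p] setT) => //.
  move=> _ [p ->]; exists (flat ('X^2 * (p - p^`()))); first by exists ('X^2 * (p - p^`())).
  by move=> t _; exact: is_derive_flat.
by exists 1.
Qed.

Lemma Cinfty_expR_remainder U f :
  open U -> Cinfty U f -> Cinfty U (expR_remainder \o f).
Proof.
move=> oU cf k; apply: (@Ck_comp _ _ _ [set phi | exists2 c : nat -> R,
    (forall i, `|c i| <= i`!%:R^-1) & phi = fun t => limn (pseries c t)] setT) => //.
  move=> _ [c cb ->]; exists (fun t => limn (pseries (pseries_diffs c) t)).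
    by exists (pseries_diffs c) => //; exact: pseries_diffs_fact.
  by move=> t _; exact: is_derive_pseries_fact.
by exists (fun i => i.+2`!%:R^-1) => //; exact: fact_remainder.
Qed.

Lemma Cinfty_hornerV (p : {poly R}) U f : open U -> (forall x, U x -> f x != 0) ->
  Cinfty U f -> Cinfty U (fun x => p.[(f x)^-1]).
Proof.
move=> oU f0 cf k.
apply: (@Ck_comp _ _ _ [set phi | exists p : {poly R}, phi = fun t => p.[t^-1]]
  [set t | t != 0] _ (fun t => p.[t^-1])) => //; last by exists p.
move=> _ [q ->]; exists (fun t => (- 'X^2 * q^`()).[t^-1]); first by exists (- 'X^2 * q^`()).
by move=> t; exact: is_derive_hornerV.
Qed.

(** The derivative 1/t of ln is a polynomial in 1/t, so adjoining ln to these polynomials keeps the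
    family stable under derivation. *)
Lemma Cinfty_ln U f : open U -> (forall x, U x -> 0 < f x) ->
  Cinfty U f -> Cinfty U (@ln R \o f).
Proof.
move=> oU f0 cf k.
apply: (@Ck_comp _ _ _ [set phi | phi = @ln R \/ exists p : {poly R}, phi = fun t => p.[t^-1]]
  [set t | 0 < t]) => //; last by left.
move=> _ [->|[q ->]].
  exists (fun t => 'X.[t^-1]); first by right; exists 'X.
  by move=> t t0; rewrite hornerX; exact: is_derive1_ln.
exists (fun t => (- 'X^2 * q^`()).[t^-1]); first by right; exists (- 'X^2 * q^`()).
by move=> t t0; apply: is_derive_hornerV; rewrite gt_eqF.
Qed.

End SmoothComposition.
(** * Smooth functions and sections *)

Section SmoothOn.
Context {R : realType} {m : nat} {M : manifold R m}.
Implicit Types (U V W : set M) (f g : M -> R) (i : chart_idx M).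

Lemma chart_img_open_sub i W : open W -> open (chart i @` (chart_dom i `&` W)).
Proof.
move=> oW; rewrite openE => _ [p [ip Wp] <-]; rewrite /interior.
have ci : (chart i @` chart_dom i) (chart i p) by exists p.
near=> x; have [] : (chart i @` chart_dom i) x /\ W (chart_inv i x); last first.
  by move=> [q iq <-]; rewrite chartK// => Wq; exists q.
split; near: x.
  by apply: open_nbhs_nbhs; split => //; exact: chart_img_open.
apply: (chart_inv_continuous ci); rewrite chartK//.
exact: open_nbhs_nbhs.
Unshelve. all: by end_near. Qed.

Lemma smooth_on_eq W f g : open W -> (forall p, W p -> f p = g p) ->
  smooth_on W f -> smooth_on W g.
Proof.
move=> oW fg cf i k; apply: Ck_eq (cf i k); first exact: chart_img_open_sub.
by move=> _ [p [ip Wp] <-]; rewrite chartK//; exact: fg.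
Qed.

Lemma smooth_on_sub U W f : U `<=` W -> smooth_on W f -> smooth_on U f.
Proof.
move=> UW cf i k; apply: Ck_sub (cf i k) => _ [p [ip Up] <-].
by exists p => //; split => //; exact: UW.
Qed.

Lemma smooth_on_local W f :
  (forall p, W p -> exists2 V, V p & smooth_on V f) -> smooth_on W f.
Proof.
move=> h i k; apply: Ck_pointwise => _ [p [ip /h[V Vp cf]] <-].
by apply: Ck_sub (cf i k) => _ ->; exists p.
Qed.

Lemma smooth_on_cst W (a : R) : smooth_on W (fun=> a).
Proof. by move=> i k; exact: Ck_cst. Qed.

Lemma smooth_onD W f g : open W -> smooth_on W f -> smooth_on W g ->
  smooth_on W (fun p => f p + g p).
Proof. by move=> oW cf cg i k; apply: CkD; [exact: chart_img_open_sub|exact: cf|exact: cg]. Qed.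

Lemma smooth_onM W f g : open W -> smooth_on W f -> smooth_on W g ->
  smooth_on W (fun p => f p * g p).
Proof. by move=> oW cf cg i k; apply: CkM; [exact: chart_img_open_sub|exact: cf|exact: cg]. Qed.

Lemma smooth_on_sum (I : Type) (s : seq I) (P : pred I) W (F : I -> M -> R) : open W ->
  (forall a, P a -> smooth_on W (F a)) -> smooth_on W (fun p => \sum_(a <- s | P a) F a p).
Proof.
move=> oW h; elim: s => [|a s IH].
  by apply: (smooth_on_eq oW _ (@smooth_on_cst W 0)) => p _; rewrite big_nil.
have [Pa|Pa] := boolP (P a).
  by apply: (smooth_on_eq oW _ (smooth_onD oW (h a Pa) IH)) => p _; rewrite big_cons Pa.
by apply: (smooth_on_eq oW _ IH) => p _; rewrite big_cons (negbTE Pa).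
Qed.

Lemma smooth_onB W f g : open W -> smooth_on W f -> smooth_on W g ->
  smooth_on W (fun p => f p - g p).
Proof.
move=> oW cf cg; apply: (smooth_on_eq oW _
  (smooth_onD oW cf (smooth_onM oW (@smooth_on_cst W (-1)) cg))) => p _.
by rewrite mulN1r.
Qed.

Lemma smooth_onX W f n : open W -> smooth_on W f -> smooth_on W (fun p => f p ^+ n).
Proof.
move=> oW cf; elim: n => [|n IH]; first exact: smooth_on_cst.
by apply: (smooth_on_eq oW _ (smooth_onM oW cf IH)) => p _; rewrite exprS.
Qed.

Lemma smooth_on_flat W f : open W -> smooth_on W f -> smooth_on W (flat 1 \o f).
Proof. by move=> oW cf i; apply: Cinfty_flat (cf i); exact: chart_img_open_sub. Qed.

Lemma smooth_on_expR_remainder W f : open W -> smooth_on W f ->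
  smooth_on W (expR_remainder \o f).
Proof.
by move=> oW cf i; apply: Cinfty_expR_remainder (cf i); exact: chart_img_open_sub.
Qed.

Lemma smooth_on_ln W f : open W -> (forall p, W p -> 0 < f p) -> smooth_on W f ->
  smooth_on W (@ln R \o f).
Proof.
move=> oW f0 cf i; apply: Cinfty_ln (cf i); first exact: chart_img_open_sub.
by move=> _ [p [ip Wp] <-]; rewrite chartK//; exact: f0.
Qed.

Lemma smooth_onV W f : open W -> (forall p, W p -> f p != 0) -> smooth_on W f ->
  smooth_on W (fun p => (f p)^-1).
Proof.
move=> oW f0 cf i.
rewrite (_ : (fun x => _) = fun x => 'X.[(f (chart_inv i x))^-1]); last first.
  by apply/funext => x; rewrite hornerX.
apply: Cinfty_hornerV (cf i); first exact: chart_img_open_sub.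
by move=> _ [p [ip Wp] <-]; rewrite chartK//; exact: f0.
Qed.

Lemma smooth_cst (a : R) : smooth (fun _ : M => a).
Proof. exact: (@smooth_on_cst setT a). Qed.

Lemma smoothD f g : smooth f -> smooth g -> smooth (fun p => f p + g p).
Proof. by move=> sf sg; apply: (smooth_onD _ sf sg); exact: openT. Qed.

Lemma smoothB f g : smooth f -> smooth g -> smooth (fun p => f p - g p).
Proof. by move=> sf sg; apply: (smooth_onB _ sf sg); exact: openT. Qed.

Lemma smoothM f g : smooth f -> smooth g -> smooth (fun p => f p * g p).
Proof. by move=> sf sg; apply: (smooth_onM _ sf sg); exact: openT. Qed.

(* Compactness in a chart domain and the Hausdorff property make the support
   closed in M, so that the bump extends by zero. *)
Lemma bump_function (p : M) W : open W -> W p ->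
  exists (beta : M -> R) (K : set M), [/\ smooth beta, beta p != 0, closed K,
    K `<=` W & forall q, ~ K q -> beta q = 0].
Proof.
move=> oW Wp; have [i ip] := chart_cover p; pose a := chart i p.
have /nbhs_ballP[e /= e0 eW] : nbhs a (chart i @` (chart_dom i `&` W)).
  by apply: open_nbhs_nbhs; split; [exact: chart_img_open_sub|exists p].
pose d := e / 2; have d0 : 0 < d by rewrite divr_gt0.
(* A box is compact as a product of segments; with half-side e / 2 it lies in the open sup-norm ball
   of radius e. *)
pose B := [set x : 'rV[R]_m | forall l, `[a 0 l - d, a 0 l + d]%classic (x 0 l)].
have BW x : B x -> (chart i @` (chart_dom i `&` W)) x.
  move=> Bx; apply: eW; split=> // k l; rewrite ord1 /ball /=.
  have := Bx l; rewrite /= in_itv /= => /andP[lo hi].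
  rewrite ltr_norml; apply/andP; split; rewrite /d in lo hi *; lra.
pose K := chart_inv i @` B.
have cK : closed K.
  apply: compact_closed; first exact: manifold_hausdorff.
  apply: continuous_compact; last first.
    exact: (@rV_compact R m (fun l => `[a 0 l - d, a 0 l + d]%classic)
      (fun=> @segment_compact _ _ _)).
  apply: continuous_in_subspaceT => x; rewrite inE => /BW[q [iq _] <-].
  by apply: chart_inv_continuous; exists q.
have KiW : K `<=` chart_dom i `&` W by move=> _ [x /BW[q iWq <-] <-]; rewrite chartK//; case: iWq.
(* A sum of squares is smooth, and u > 0 bounds each coordinate difference by d, so the bump
   vanishes off K. *)
pose u q := d ^+ 2 - \sum_l (chart i q 0 l - a 0 l) ^+ 2.
pose beta q := if `[< chart_dom i q >] then flat 1 (u q) else 0.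
have betaK q : ~ K q -> beta q = 0.
  rewrite /beta; case: asboolP => // iq; apply: contra_notP; rewrite /flat.
  case: ifPn => // uq _; exists (chart i q); last exact: chartK.
  move=> l; rewrite /= in_itv /= -ler_distl -(@ler_pXn2r _ 2) ?nnegrE ?(ltW d0)//.
  rewrite real_normK ?num_real//; move: uq; rewrite /u subr_gt0 => /ltW; apply: le_trans.
  by rewrite (bigD1 l)//= lerDl sumr_ge0// => k _; exact: sqr_ge0.
exists beta, K; split => //; last by move=> q /KiW[].
- apply: smooth_on_local => q _; have [Kq|Kq] := pselect (K q).
    exists (chart_dom i); first by have [] := KiW q Kq.
    have oi := chart_dom_open i.
    apply: (@smooth_on_eq _ (flat 1 \o u)) => //.
      by move=> s si; rewrite /beta asboolT.
    apply: smooth_on_flat => //; apply: (smooth_onB oi (@smooth_on_cst _ _)).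
    apply: smooth_on_sum => // l _; apply: smooth_onX => //.
    by apply: (smooth_onB oi _ (@smooth_on_cst _ _)) => j; exact: chart_transition.
  exists (~` K) => //; apply: (@smooth_on_eq _ (fun=> 0)); last exact: smooth_on_cst.
    by rewrite openC.
  by move=> s /betaK ->.
- rewrite /beta asboolT// /u big1 => [|l _]; last by rewrite subrr expr0n.
  by rewrite subr0 /flat exprn_gt0// hornerE mul1r gt_eqF// expR_gt0.
Qed.

End SmoothOn.

Section SectionExtension.
Context {R : realType} {m : nat} {M : manifold R m} {r : nat} {A : vbundle M r}.

(** A combination of a local frame with constant coefficients is cut off by a bump; dividing by
    [beta p] restores the value v at p. Hence [extend] never falls back on its default 0. *)
Lemma smooth_section_extension (p : M) (v : A p) :
  exists X : rsection A, smooth_section X /\ X p = v.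
Proof.
have [j jp] := frame_cover A p; have oj := frame_dom_open j.
have [beta [K [cb bp cK Kj bK]]] := bump_function oj jp.
pose c a := coord (frame j p) a v / beta p.
pose X : rsection A := fun q => \sum_a (beta q * c a) *: tnth (frame j q) a.
exists X; split; last first.
  rewrite [RHS](coord_basis (frame_basis jp) (memvf v)) /X; apply: eq_bigr => a _.
  by rewrite /c mulrCA divff// mulr1 (tnth_nth 0).
move=> k b; apply: smooth_on_local => q kq; have [Kq|Kq] := pselect (K q).
  exists (frame_dom j `&` frame_dom k); first by split => //; exact: Kj.
  have ojk : open (frame_dom j `&` frame_dom k) by apply: openI => //; exact: frame_dom_open.
  apply: (@smooth_on_eq _ _ _ _ (fun q =>
    \sum_a beta q * c a * coord (frame k q) b (tnth (frame j q) a))) => //.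
    by move=> s _; rewrite linear_sum; apply: eq_bigr => a _; rewrite linearZ.
  apply: smooth_on_sum => // a _; apply: (smooth_onM ojk _ (@frame_transition _ _ _ _ _ _ _ _ _)).
  by apply: (smooth_onM ojk _ (@smooth_on_cst _ _ _ _ _)); exact: smooth_on_sub cb.
exists (~` K) => //; apply: (@smooth_on_eq _ _ _ _ (fun=> 0)); last exact: smooth_on_cst.
  by rewrite openC.
move=> s /bK bs; rewrite /X big1 ?linear0// => a _.
by rewrite bs mul0r scale0r.
Qed.

Lemma extend_val (p : M) (v : A p) : extend v p = v.
Proof.
rewrite /extend; case: pselect => [h|]; last by have := smooth_section_extension v.
by case: cid => X /= [].
Qed.

Lemma smooth_extend (p : M) (v : A p) : smooth_section (extend v).
Proof.
rewrite /extend; case: pselect => [h|]; last by have := smooth_section_extension v.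
by case: cid => X /= [].
Qed.

End SectionExtension.
(** * Alternating forms *)

Section Deletion.
Variables (T : Type).
Implicit Types (s : seq T).

Lemma size_del i s : (i < size s)%N -> size (del i s) = (size s).-1.
Proof.
by move=> is_; rewrite /del size_cat size_drop size_takel ?(ltnW is_)//; lia.
Qed.

Lemma nth_del x0 i s l : (i < size s)%N -> nth x0 (del i s) l = nth x0 s (bump i l).
Proof.
move=> is_; rewrite /del nth_cat size_takel ?(ltnW is_)// /bump.
case: ltnP => li; first by rewrite nth_take.
by rewrite nth_drop add1n addSn subnKC.
Qed.

Lemma map_del (S : Type) (h : T -> S) i s : map h (del i s) = del i (map h s).
Proof. by rewrite /del map_cat map_take map_drop. Qed.

End Deletion.

Section AlternatingForms.
Context {R : realType} {V : vectType R}.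
Implicit Types (f g : seq V -> R) (s u v : seq V) (x y : V) (k : nat).

Lemma alternating0 k : alternating k (fun _ : seq V => 0 : R).
Proof. by split=> // a x y s1 s2; rewrite mulr0 addr0. Qed.

Lemma alternatingD k f g :
  alternating k f -> alternating k g -> alternating k (fun s => f s + g s).
Proof.
move=> [f1 f2 f3] [g1 g2 g3]; split=> [s hs|a x y s1 s2|s hs].
- by rewrite f1// g1// addr0.
- by rewrite f2 g2; ring.
- by rewrite f3// g3// addr0.
Qed.

Lemma alternatingZ k (a : R) f : alternating k f -> alternating k (fun s => a * f s).
Proof.
move=> [f1 f2 f3]; split=> [s hs|b x y s1 s2|s hs].
- by rewrite f1// mulr0.
- by rewrite f2; ring.
- by rewrite f3// mulr0.
Qed.

Lemma alternating_sum k (I : Type) (l : seq I) (F : I -> seq V -> R) :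
  (forall i, alternating k (F i)) -> alternating k (fun s => \sum_(i <- l) F i s).
Proof.
move=> h; elim: l => [|i l IH].
  by under eq_fun do rewrite big_nil; exact: alternating0.
by under eq_fun do rewrite big_cons; exact: alternatingD.
Qed.

Lemma form_sum k f (I : Type) (l : seq I) (c : I -> R) (X : I -> V) u v :
  alternating k f ->
  f (u ++ (\sum_(i <- l) c i *: X i) :: v) = \sum_(i <- l) c i * f (u ++ X i :: v).
Proof.
move=> [_ lin _]; elim: l => [|i l IH].
  by rewrite !big_nil; have := lin (-1) 0 0 u v; rewrite scaler0 addr0 => ->; ring.
by rewrite !big_cons lin IH.
Qed.

Lemma alternating_swap k f u x y v : alternating k f ->
  f (u ++ x :: y :: v) = - f (u ++ y :: x :: v).
Proof.
move=> [_ lin alt]; pose z := x + y.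
have uu w : f (u ++ w :: w :: v) = 0.
  by apply: alt; rewrite cat_uniq /= mem_head !andbF.
have E w : f (u ++ z :: w :: v) = f (u ++ x :: w :: v) + f (u ++ y :: w :: v).
  by rewrite -[z]/(x + y) -[x]scale1r lin mul1r scale1r.
have F w : f (u ++ w :: z :: v) = f (u ++ w :: x :: v) + f (u ++ w :: y :: v).
  by rewrite -[z]/(x + y) -!(cat_rcons w) -[x]scale1r lin mul1r scale1r.
have := uu z; rewrite E !F !uu add0r addr0 => /eqP.
by rewrite addr_eq0 => /eqP.
Qed.

(** Transporting only the vanishing of f along a permutation avoids all bookkeeping of signs. *)
Lemma alternating_perm_eq0 k f s s' : alternating k f ->
  perm_eq s s' -> f s = 0 -> f s' = 0.
Proof.
move=> altf; have step u x s2 v : f (u ++ x :: s2 ++ v) = 0 -> f (u ++ s2 ++ x :: v) = 0.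
  elim: s2 u => [//|y s2 IH] u /= h; rewrite -cat_rcons; apply: IH.
  by rewrite cat_rcons (alternating_swap _ _ _ _ altf) h oppr0.
suff block s1 s2 s3 u : f (u ++ s1 ++ s2 ++ s3) = 0 -> f (u ++ s2 ++ s1 ++ s3) = 0.
  by move=> pss'; move: s s' pss'; apply: catCA_perm_ind => s1 s2 s3; exact: (block _ _ _ [::]).
elim: s1 u => [//|x s1 IH] u /= h; apply: step.
by rewrite -cat_rcons; apply: IH; rewrite cat_rcons.
Qed.

(** Arguments are expanded one at a time, the prefix l holding the vectors [e i] already
    substituted. A list of these either has a repetition or is a permutation of an increasing one.
    The form of the statement serves both [vbasis] and the frames of a bundle. *)
Lemma alternating_basis_eq0 k r (e : 'I_r -> V) (c : V -> 'I_r -> R) f :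
    (forall x, x = \sum_i c x i *: e i) -> alternating k f ->
    (forall I : {set 'I_r}, f [seq e i | i <- enum I] = 0) ->
  forall s, f s = 0.
Proof.
move=> ce altf f0; have fe l : f [seq e i | i <- l] = 0.
  have [ul|nul] := boolP (uniq l).
    apply: alternating_perm_eq0 altf _ (f0 [set i in l]).
    apply/perm_map/uniq_perm; rewrite ?enum_uniq// => i.
    by rewrite mem_enum inE.
  by case: altf => _ _; apply; apply: contra nul; exact: map_uniq.
suff h s : forall l, f ([seq e i | i <- l] ++ s) = 0 by move=> s; exact: (h s [::]).
elim: s => [|x s IH] l; first by rewrite cats0.
rewrite [x]ce (form_sum _ _ _ _ _ altf) big1// => i _.
by rewrite -cat_rcons -map_rcons IH mulr0.
Qed.

End AlternatingForms.

(** * Wedges, dual bases and contraction *)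

Section Wedge.
Context {R : realType} {V : vectType R}.
Implicit Types (ys : seq V) (bs : seq (dual V)).

Lemma wedge_det k ys bs : size ys = k -> size bs = k ->
  wedge ys bs = \det (\matrix_(i < k, j < k) (bs`_i) (ys`_j)).
Proof. by move=> <- hb; rewrite /wedge hb eqxx. Qed.

Lemma alternating_wedge bs : alternating (size bs) (fun ys => wedge ys bs).
Proof.
split=> [ys hs|a x y u v|ys].
- by rewrite /wedge eq_sym ifN//; apply/eqP.
- set k := size bs; have [hk|hk] := eqVneq (size (u ++ x :: v)) k; last first.
    have h z : wedge (u ++ z :: v) bs = 0.
      by rewrite /wedge ifN// eq_sym; move: hk; rewrite !size_cat.
    by rewrite !h mulr0 addr0.
  have hz z : size (u ++ z :: v) = k by rewrite -hk !size_cat.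
  have wz z : wedge (u ++ z :: v) bs = \det (\matrix_(j < k, i < k) (bs`_i) ((u ++ z :: v)`_j)).
    rewrite (wedge_det (hz z) erefl) -det_tr; congr (\det _).
    by apply/matrixP => i j; rewrite !mxE.
  rewrite !wz -[X in _ = _ + X]mul1r.
  have ku : (size u < k)%N by rewrite -(hz x) size_cat /= addnS ltnS leq_addr.
  have nthz z : (u ++ z :: v)`_(size u) = z by rewrite nth_cat ltnn subnn.
  have nthN (j : 'I_k) z z' : j != Ordinal ku -> (u ++ z :: v)`_j = (u ++ z' :: v)`_j.
    rewrite -val_eqE /= !nth_cat => jk; case: ltnP => // uj.
    by case E : (j - size u)%N => //=; exfalso; move: jk E uj; lia.
  apply: (@determinant_multilinear _ _ _ _ _ (Ordinal ku)).
  + by apply/rowP => i; rewrite !mxE /= !nthz linearD linearZ mul1r.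
  + by apply/matrixP => i j; rewrite !mxE; congr (bs`_j _); apply: nthN; rewrite eq_sym neq_lift.
  + by apply/matrixP => i j; rewrite !mxE; congr (bs`_j _); apply: nthN; rewrite eq_sym neq_lift.
- case/(uniqPn 0) => i [j [ij js nij]]; rewrite /wedge; case: ifP => // _.
  rewrite -det_tr; apply: (@determinant_alternate _ _ _ (Ordinal (ltn_trans ij js)) (Ordinal js)).
    by rewrite -val_eqE /= ltn_eqF.
  by move=> l; rewrite !mxE /= nij.
Qed.

Definition basis_vecs (I : {set 'I_(\dim {:V})}) : seq V := [seq basis_vec i | i <- enum I].
Definition basis_covecs (I : {set 'I_(\dim {:V})}) : seq (dual V) :=
  [seq basis_covec i | i <- enum I].

Lemma basis_covecE (i : 'I_(\dim {:V})) x : basis_covec i x = coord (vbasis {:V}) i x.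
Proof. by rewrite lfunE. Qed.

Lemma basis_expansion (x : V) : x = \sum_i basis_covec i x *: basis_vec i.
Proof.
rewrite {1}(coord_vbasis (memvf x)); apply: eq_bigr => i _.
by rewrite basis_covecE.
Qed.

Lemma basis_covec_vec (i j : 'I_(\dim {:V})) : basis_covec i (basis_vec j) = (i == j)%:R.
Proof.
by rewrite basis_covecE coord_free ?(basis_free (vbasisP _))// eq_sym.
Qed.

Lemma wedge_basis (I J : {set 'I_(\dim {:V})}) :
  wedge (basis_vecs J) (basis_covecs I) = (I == J)%:R.
Proof.
have [<-{J}|IJ] := eqVneq.
  rewrite (@wedge_det #|I|) ?size_map -?cardE//.
  rewrite (_ : \matrix_(i, j) _ = 1%:M) ?det1//; apply/matrixP => i j; rewrite !mxE.
  have i0 := enum_val i.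
  rewrite !(nth_map i0) -?cardE// basis_covec_vec (nth_uniq _ _ _ (enum_uniq _)) -?cardE//.
have [cIJ|cIJ] := eqVneq #|I| #|J|; last first.
  by rewrite /wedge !size_map -!cardE (negbTE cIJ).
(* Equal cardinals and I != J give some x in J outside I; the column of [basis_vec x] is then
   zero. *)
have /subsetPn[x xJ xI] : ~~ (J \subset I).
  by apply: contra IJ => JI; rewrite eq_sym eqEcard JI cIJ leqnn.
rewrite (@wedge_det #|J|) ?size_map -?cardE//.
have xk : (index x (enum J) < #|J|)%N by rewrite cardE index_mem mem_enum.
rewrite (expand_det_col _ (Ordinal xk)) big1// => i _; rewrite mxE /=.
rewrite !(nth_map x) -?cardE ?cIJ// basis_covec_vec nth_index ?mem_enum//.
suff /negbTE -> : nth x (enum I) i != x by rewrite mul0r.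
by apply: contra xI => /eqP <-; rewrite -mem_enum mem_nth// -cardE cIJ.
Qed.

Lemma alternating_expansion k (a : seq V -> R) ys : alternating k a ->
  a ys = \sum_I a (basis_vecs I) * wedge ys (basis_covecs I).
Proof.
move=> alta; apply/eqP; rewrite -subr_eq0 -mulN1r; apply/eqP; move: ys.
pose F (I : {set 'I_(\dim {:V})}) ys := a (basis_vecs I) * wedge ys (basis_covecs I).
have altF I : alternating k (F I).
  (* The wedge factor has degree #|I|; when this is not k, the coefficient [a (basis_vecs I)] is
     zero. *)
  have [sI|sI] := eqVneq (size (basis_covecs I)) k.
    by apply: alternatingZ; rewrite -sI; exact: alternating_wedge.
  rewrite /F (_ : a _ = 0); last first.
    by case: alta => + _ _; apply; apply/eqP; move: sI; rewrite !size_map.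
  by under eq_fun do rewrite mul0r; exact: alternating0.
apply: (alternating_basis_eq0 basis_expansion (k := k)
  (f := fun ys => a ys + -1 * \sum_I F I ys)) => [|J].
  apply: alternatingD => //; apply: alternatingZ; exact: alternating_sum.
rewrite (bigD1 J)//= big1 => [|I IJ]; rewrite /F wedge_basis; last by rewrite (negbTE IJ) mulr0.
by rewrite eqxx mulr1 addr0 mulN1r subrr.
Qed.

Lemma wedge_laplace k ys bs b : size ys = k.+1 -> size bs = k ->
  wedge ys (rcons bs b)
  = \sum_(j < k.+1) (-1) ^+ (k + j) * b ys`_j * wedge (del j ys) bs.
Proof.
move=> sy sb; rewrite (@wedge_det k.+1) ?size_rcons ?sb// (expand_det_row _ ord_max).
apply: eq_bigr => j _; rewrite mxE /= nth_rcons sb ltnn eqxx.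
rewrite /cofactor mulrCA mulrA; congr (_ * _).
rewrite (@wedge_det k) ?size_del ?sy//; congr (\det _); apply/matrixP => i l.
by rewrite !mxE lift_max nth_rcons sb ltn_ord nth_del ?sy.
Qed.

(** After Laplace expansion along the row of b, the last one, the sum over I reassembles the values
    of a by [alternating_expansion]. The right-hand side no longer mentions the chosen basis of the
    fibre. *)
Lemma contract_wedge k (a : seq V -> R) ys b : alternating k a -> size ys = k.+1 ->
  contract a (wedge ys) [:: b]
  = \sum_(j < k.+1) (-1) ^+ (k + j) * a (del j ys) * b ys`_j.
Proof.
move=> alta sy; under [RHS]eq_bigr => j _ do
  rewrite (alternating_expansion _ alta) mulr_sumr mulr_suml.
rewrite exchange_big /=; apply: eq_bigr => I _; rewrite cats1 -/(basis_vecs I) -/(basis_covecs I).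
have [sI|sI] := eqVneq (size (basis_covecs I)) k; last first.
  have -> : a (basis_vecs I) = 0.
    by case: alta => + _ _; apply; apply/eqP; move: sI; rewrite !size_map.
  by rewrite mul0r big1// => j _; ring.
rewrite (wedge_laplace _ sy sI) mulr_sumr; apply: eq_bigr => j _; ring.
Qed.

Lemma vec_of_bidual_contract_wedge k (a : seq V -> R) ys : alternating k a -> size ys = k.+1 ->
  vec_of_bidual (contract a (wedge ys))
  = \sum_(j < k.+1) ((-1) ^+ (k + j) * a (del j ys)) *: ys`_j.
Proof.
move=> alta sy; rewrite /vec_of_bidual.
under eq_bigr => i _ do rewrite (contract_wedge _ alta sy) scaler_suml.
rewrite exchange_big /=; apply: eq_bigr => j _.
rewrite [in RHS](basis_expansion ys`_j) scaler_sumr; apply: eq_bigr => i _.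
by rewrite scalerA.
Qed.

End Wedge.
(** * Evaluation of smooth forms *)

Section SmoothSections.
Context {R : realType} {m : nat} {M : manifold R m} {r : nat} {A : vbundle M r}.
Implicit Types (X Y : rsection A) (Xs Ys : seq (rsection A)) (alpha : rform A).

(** The default zero section is the one with which [koszul] reads its arguments. *)
Definition smooth_sections Xs : Prop :=
  forall i, smooth_section (nth (fun=> 0) Xs i).

Lemma smooth_section_sum (I : Type) (l : seq I) (f : I -> M -> R) (Y : I -> rsection A) :
  (forall a, smooth (f a)) -> (forall a, smooth_section (Y a)) ->
  smooth_section (fun q => \sum_(a <- l) f a q *: Y a q).
Proof.
move=> sf sY j b; have oj := frame_dom_open j.
apply: (@smooth_on_eq _ _ _ _ (fun q => \sum_(a <- l) f a q * coord (frame j q) b (Y a q))) => //.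
  by move=> q _; rewrite linear_sum; apply: eq_bigr => a _; rewrite linearZ.
apply: smooth_on_sum => // a _; apply: (smooth_onM oj _ (sY a j b)).
exact: smooth_on_sub (sf a).
Qed.

Lemma smooth_section0 : smooth_section (fun=> 0 : A _).
Proof.
move=> j b; apply: (@smooth_on_eq _ _ _ _ (fun=> 0)); first exact: frame_dom_open.
  by move=> q _; rewrite linear0.
exact: smooth_on_cst.
Qed.

Lemma smooth_sections_del Xs i : (i < size Xs)%N ->
  smooth_sections Xs -> smooth_sections (del i Xs).
Proof. by move=> iX sX l; rewrite nth_del//; exact: sX. Qed.

Lemma smooth_sections_cons X Xs :
  smooth_section X -> smooth_sections Xs -> smooth_sections (X :: Xs).
Proof. by move=> sX sXs [|i] //=; exact: sXs. Qed.

Lemma smooth_sections_extend (p : M) (vs : seq (A p)) :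
  smooth_sections [seq extend v | v <- vs].
Proof.
elim: vs => [|v vs IH]; first by move=> i; rewrite nth_nil; exact: smooth_section0.
by apply: smooth_sections_cons => //; exact: smooth_extend.
Qed.

Lemma eval_at_extend (p : M) (vs : seq (A p)) : eval_at p [seq extend v | v <- vs] = vs.
Proof. by rewrite /eval_at -map_comp map_id_in// => v _; exact: extend_val. Qed.

(** Smoothness of a form is given on frame vectors only, so the sections are expanded in a local
    frame one by one, while l collects the frame indices. *)
Lemma smooth_form_eval k alpha Xs : smooth_form k alpha -> smooth_sections Xs ->
  smooth (fun q => alpha q (eval_at q Xs)).
Proof.
move=> [alta sa] sX.
suff h j : forall l : seq 'I_r, smooth_on (frame_dom j)
    (fun q => alpha q ([seq tnth (frame j q) i | i <- l] ++ eval_at q Xs)).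
  apply: smooth_on_local => p _; have [j jp] := frame_cover A p.
  by exists (frame_dom j) => //; exact: (h j [::]).
have oj := frame_dom_open j.
elim: Xs sX => [|X Xs IH] sX l.
  apply: (@smooth_on_eq _ _ _ _ (fun q => alpha q [seq tnth (frame j q) i | i <- l])) => //.
    by move=> q _; rewrite cats0.
  have [lk|lk] := eqVneq (size l) k.
    by move/eqP: lk => lk; exact: (sa j (Tuple lk)).
  apply: (@smooth_on_eq _ _ _ _ (fun=> 0)) => //; last exact: smooth_on_cst.
  by move=> q _; have [-> //] := alta q; rewrite size_map; exact/eqP.
have sXs : smooth_sections Xs by move=> i; exact: (sX i.+1).
apply: (@smooth_on_eq _ _ _ _ (fun q => \sum_b coord (frame j q) b (X q) *
  alpha q ([seq tnth (frame j q) i | i <- rcons l b] ++ eval_at q Xs))) => //.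
  move=> q jq /=; rewrite [in RHS](coord_basis (frame_basis jq) (memvf (X q))).
  rewrite (form_sum _ _ _ _ _ (alta q)); apply: eq_bigr => b _.
  by rewrite map_rcons cat_rcons (tnth_nth 0).
by apply: smooth_on_sum => // b _; apply: (smooth_onM oj (sX 0 j b)); exact: IH.
Qed.

End SmoothSections.

(** * Volume forms and their ratio *)

Section TopForms.
Context {R : realType} {m : nat} {M : manifold R m} {r : nat} {A : vbundle M r}.

Lemma top_form_eq0 (V : vectType R) (e : r.-tuple V) (f : seq V -> R) :
  basis_of fullv e -> alternating r f -> f e = 0 -> forall s, f s = 0.
Proof.
move=> be altf fe; apply: (@alternating_basis_eq0 _ _ r r (tnth e) (fun x i => coord e i x)) => //.
  move=> x; rewrite {1}(coord_basis be (memvf x)).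
  by apply: eq_bigr => i _; rewrite (tnth_nth 0).
move=> I; have [Ir|Ir] := eqVneq #|I| r; last first.
  by case: altf => + _ _; apply; rewrite size_map -cardE; exact/eqP.
have -> : I = finset.setTfor 'I_r.
  by apply/eqP; rewrite eqEcard finset.subsetT cardsT card_ord Ir leqnn.
by rewrite finset.enum_setT -enumT map_tnth_enum.
Qed.

(** The top form g(e) f - f(e) g vanishes on the basis e. *)
Lemma top_form_proportional (V : vectType R) (e : r.-tuple V) (f g : seq V -> R) :
  basis_of fullv e -> alternating r f -> alternating r g ->
  forall s, g e * f s = f e * g s.
Proof.
move=> be altf altg s; apply/eqP; rewrite -subr_eq0 -mulNr; apply/eqP.
apply: (@top_form_eq0 _ e (fun s => g e * f s + - f e * g s)) => //.
  by apply: alternatingD; exact: alternatingZ.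
ring.
Qed.

Lemma smooth_form_frame (mu : rform A) (j : frame_idx A) : smooth_form r mu ->
  smooth_on (frame_dom j) (fun p => mu p (frame j p)).
Proof.
move=> [_ /(_ j (ord_tuple r))].
apply: smooth_on_eq; first exact: frame_dom_open.
by move=> p _; rewrite val_ord_tuple map_tnth_enum.
Qed.

Lemma volume_frame_neq0 (mu : rform A) (j : frame_idx A) p :
  smooth_form r mu -> nowhere_vanishing mu -> frame_dom j p -> mu p (frame j p) != 0.
Proof.
move=> [altmu _] /(_ p)[s mus] jp; apply: contra mus => /eqP mue.
by rewrite (top_form_eq0 (frame_basis jp) (altmu p) mue).
Qed.

Lemma volume_ratio (mu mu' : rform A) :
  smooth_form r mu -> nowhere_vanishing mu ->
  smooth_form r mu' -> nowhere_vanishing mu' ->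
  exists g : M -> R, [/\ smooth g, forall p, g p != 0 &
    mu' = fun p vs => g p * mu p vs].
Proof.
move=> smu mu0 smu' mu0'.
(* The frame is picked separately at each point. By proportionality the ratio is the same in every
   frame, and smoothness near p is read in a fixed one. *)
pose j p := projT1 (cid (frame_cover A p)).
have jP p : frame_dom (j p) p by rewrite /j; case: cid.
pose g p := mu' p (frame (j p) p) / mu p (frame (j p) p).
have gE p s : mu' p s = g p * mu p s.
  have e0 := volume_frame_neq0 smu mu0 (jP p).
  apply: (mulfI e0); rewrite mulrA mulrC /g mulrCA divff// mulr1.
  by rewrite mulrC; apply: top_form_proportional (frame_basis (jP p)) _ _ _;
    [case: smu'|case: smu].
exists g; split; last by apply: functional_extensionality_dep => p; apply/funext => s.
- apply: smooth_on_local => p _; have [k kp] := frame_cover A p.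
  exists (frame_dom k) => //; have ok := frame_dom_open k.
  apply: (@smooth_on_eq _ _ _ _ (fun q => mu' q (frame k q) * (mu q (frame k q))^-1)) => //.
    by move=> q kq; rewrite gE mulfK//; exact: volume_frame_neq0.
  apply: (smooth_onM ok (smooth_form_frame _ smu')).
  apply: (smooth_onV ok _ (smooth_form_frame _ smu)) => q kq.
  exact: volume_frame_neq0.
- move=> p; have [s] := mu0' p; rewrite gE.
  by apply: contra => /eqP ->; rewrite mul0r.
Qed.

End TopForms.

(** * Smoothness of the sharp map *)

Section Sharp.
Context {R : realType} {m : nat} {M : manifold R m} {r : nat}.
Context {A : lie_algebroid M r}.

(* The decomposition of Pi that comes with the Schouten bracket makes sharp Pi
   alpha a combination of the decomposing sections. *)
Lemma smooth_sharp n (Pi : rmultisection A) (alpha : rform A) :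
  nambu n Pi -> smooth_form n.-1 alpha -> smooth_section (sharp Pi alpha).
Proof.
case: n => [[]//|n] [_ _ nPi] sa; have [N [Y [sY PiE _]]] := nPi alpha sa.
have [alta _] := sa.
pose Ys a : seq (rsection A) := [seq Y a i | i <- enum 'I_n.+1].
have szY a : size (Ys a) = n.+1 by rewrite size_map size_enum_ord.
have sYs a : smooth_sections (Ys a).
  move=> i; have [isz|isz] := ltnP i (size (Ys a)); last first.
    by rewrite nth_default//; exact: smooth_section0.
  rewrite /Ys (nth_map ord0) ?size_enum_ord -?(szY a)//; exact: sY.
have -> : sharp Pi alpha = fun p => \sum_(aj : 'I_N * 'I_n.+1)
    ((-1) ^+ (n + aj.2) * alpha p (eval_at p (del aj.2 (Ys aj.1)))) *:
    nth (fun=> 0) (Ys aj.1) aj.2 p.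
  apply: functional_extensionality_dep => p; rewrite /sharp.
  rewrite -(pair_bigA _ (fun (a : 'I_N) (j : 'I_n.+1) =>
    ((-1) ^+ (n + j) * alpha p (eval_at p (del j (Ys a)))) *:
    nth (fun=> 0) (Ys a) j p)) /=.
  have cE bs : contract (alpha p) (Pi p) bs
      = \sum_(a < N) contract (alpha p) (wedge (eval_at p (Ys a))) bs.
    rewrite /contract exchange_big /=; apply: eq_bigr => I _.
    rewrite PiE mulr_sumr; apply: eq_bigr => a _.
    by rewrite /eval_at /Ys -map_comp.
  rewrite /vec_of_bidual; under [LHS]eq_bigr => i _ do rewrite cE scaler_suml.
  rewrite exchange_big /=; apply: eq_bigr => a _.
  have sz : size (eval_at p (Ys a)) = n.+1 by rewrite size_map szY.
  rewrite -/(vec_of_bidual _) (vec_of_bidual_contract_wedge (alta p) sz).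
  apply: eq_bigr => j _; rewrite /eval_at map_del; congr (_ *: _).
  by rewrite (nth_map (fun=> 0)) ?szY.
apply: smooth_section_sum => [[a j]|[a j]] /=; last exact: sYs.
apply: smooth_onM; [exact: openT|exact: smooth_on_cst|].
apply: smooth_form_eval sa _; apply: smooth_sections_del => //.
by rewrite szY.
Qed.

End Sharp.
(** * Derivations and Lie derivatives *)

Section Derivations.
Context {R : realType} {m : nat} {M : manifold R m}.
Variables (p : M) (D : (M -> R) -> R).
Hypothesis tD : tangent_vector p D.
Implicit Types f g h : M -> R.

Lemma derivation_cst (a : R) : D (fun=> a) = 0.
Proof.
case: tD => lin leib; have s1 b : smooth (fun _ : M => b) by exact: smooth_cst.
have D1 : D (fun=> 1) = 0.
  have := leib _ _ (s1 1) (s1 1); under eq_fun do rewrite mul1r.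
  by rewrite !mul1r => h; lra.
have D0 : D (fun=> 0) = 0.
  have := lin (-1) _ _ (s1 0) (s1 0); under eq_fun do rewrite mulr0 addr0.
  by move=> h; lra.
have := lin a _ _ (s1 1) (s1 0); under eq_fun do rewrite mulr1 addr0.
by rewrite D1 D0 mulr0 addr0.
Qed.

Lemma derivationZ (a : R) f : smooth f -> D (fun q => a * f q) = a * D f.
Proof.
case: tD => lin _ sf; have := lin a _ _ sf (smooth_cst 0).
by under eq_fun do rewrite addr0; rewrite derivation_cst addr0.
Qed.

Lemma derivationB f g : smooth f -> smooth g -> D (fun q => f q - g q) = D f - D g.
Proof.
case: tD => lin _ sf sg; have := lin (-1) _ _ sg sf.
by under eq_fun do rewrite mulN1r addrC; move=> ->; rewrite mulN1r addrC.
Qed.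

(* Hadamard's expansion of exp around h p: the quadratic remainder is killed by
   the product rule. *)
Lemma derivation_expR h : smooth h -> D (expR \o h) = expR (h p) * D h.
Proof.
case: (tD) => lin leib sh; pose u q := h q - h p.
have su : smooth u by exact: smoothB sh (smooth_cst _).
have Du : D u = D h.
  by rewrite derivationB ?derivation_cst ?subr0//; exact: smooth_cst.
(* Then exp u = 1 + u + u w, and both u and w vanish at p, so the product rule gives D (u w) = 0. *)
pose w q := u q * expR_remainder (u q).
have sw : smooth w.
  by apply: (smoothM su); apply: (smooth_on_expR_remainder _ su); exact: openT.
have suw : smooth (fun q => u q * w q) by exact: smoothM su sw.
have Duw : D (fun q => u q * w q) = 0.
  by rewrite leib// /w /u subrr !mul0r addr0.
have -> : expR \o h = fun q => expR (h p) * (1 * u q + u q * w q) + expR (h p).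
  apply/funext => q /=; rewrite -[h q](subrK (h p)) -/(u q) expRD expR_remainderE /w; ring.
rewrite lin ?derivation_cst ?addr0.
- by rewrite lin// Duw mul1r addr0 Du.
- exact: smoothD (smoothM (smooth_cst 1) su) suw.
- exact: smooth_cst.
Qed.

End Derivations.

(* ln |g|, written with a square because the square is smooth wherever g is. *)
Definition log_abs {R : realType} {T : Type} (g : T -> R) (q : T) : R :=
  2^-1 * ln (g q ^+ 2).

Section LogAbs.
Context {R : realType} {m : nat} {M : manifold R m}.
Variable g : M -> R.
Hypotheses (sg : smooth g) (g0 : forall p, g p != 0).

Let sqr_gt0 p : 0 < g p ^+ 2. Proof. by rewrite exprn_even_gt0//= g0. Qed.

Let smooth_ln_sqr : smooth (fun q => ln (g q ^+ 2)).
Proof.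
apply: (@smooth_on_ln _ _ _ _ (fun q => g q ^+ 2)) => //; first exact: openT.
by apply: smooth_onX => //; exact: openT.
Qed.

Lemma smooth_log_abs : smooth (log_abs g).
Proof.
exact: smoothM (smooth_cst _) smooth_ln_sqr.
Qed.

(** The chain rule for exp at ln (g^2) reads 2 g D g = g^2 D (ln (g^2)), which is solved for the
    last factor. *)
Lemma derivation_log_abs p (D : (M -> R) -> R) : tangent_vector p D ->
  D (log_abs g) = D g / g p.
Proof.
move=> tD; rewrite /log_abs (derivationZ tD)//.
have := derivation_expR tD smooth_ln_sqr.
have -> : expR \o (fun q => ln (g q ^+ 2)) = fun q => g q * g q.
  by apply/funext => q /=; rewrite lnK ?expr2// posrE sqr_gt0.
have [_ ->]// := tD; rewrite lnK ?posrE ?sqr_gt0// => h.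
apply: (mulfI (lt0r_neq0 (sqr_gt0 p))).
by rewrite mulrCA -h; have gp := g0 p; field.
Qed.

End LogAbs.

(** * Rescaling a form in Cartan's formula *)

Section LieDerivative.
Context {R : realType} {m : nat} {M : manifold R m} {r : nat}.
Context {A : lie_algebroid M r}.
Implicit Types (X : rsection A) (Xs : seq (rsection A)) (alpha : rform A).

(** Only the anchor terms differentiate g; the bracket terms are pointwise linear in alpha. Asking
    for smooth evaluations rather than [smooth_form] lets the lemma apply directly to
    [iota X alpha]. *)
Lemma koszul_scale (g : M -> R) alpha Xs p : smooth g ->
  (forall Ys, smooth_sections Ys -> smooth (fun q => alpha q (eval_at q Ys))) ->
  smooth_sections Xs ->
  koszul (fun q vs => g q * alpha q vs) Xs p = g p * koszul alpha Xs p
    + \sum_(i < size Xs) (-1) ^+ i * anchor (nth (fun=> 0) Xs i p) g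
                         * alpha p (eval_at p (del i Xs)).
Proof.
move=> sg salpha sX; rewrite /koszul mulrDr addrAC; congr (_ + _).
  rewrite mulr_sumr -big_split; apply: eq_bigr => i _ /=.
  have [_ ->]// := anchor_tangent (nth (fun=> 0) Xs i p); first by ring.
  exact/salpha/smooth_sections_del.
rewrite mulr_sumr; apply: eq_bigr => j _; rewrite mulr_sumr; apply: eq_bigr => i _.
ring.
Qed.

(** Putting X first shifts the other indices by one, so the terms rho(X_i)(g) from iota_X d and from
    d iota_X cancel. The term of index 0 in iota_X d remains and gives rho(X)(g) alpha. *)
Lemma lieD_scale k (g : M -> R) alpha X p (vs : seq (A p)) : smooth g ->
  smooth_form k alpha -> smooth_section X ->
  lieD X (fun q ws => g q * alpha q ws) vs
  = g p * lieD X alpha vs + anchor (X p) g * alpha p vs.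
Proof.
move=> sg sa sX; rewrite /lieD {1 3}/iota /dA /=.
have sE := smooth_sections_extend vs.
rewrite (koszul_scale _ sg).
- rewrite (@koszul_scale g (iota X alpha))//; last first.
    move=> Ys sYs; exact: (smooth_form_eval sa (smooth_sections_cons sX sYs)).
  rewrite big_ord_recl /= extend_val expr0 mul1r {1}/del /= drop0 eval_at_extend.
  rewrite (_ : \sum_(i < _) _ = - \sum_(i < size [seq extend v | v <- vs])
     (-1) ^+ i * anchor (nth (fun=> 0) [seq extend v | v <- vs] i p) g *
      iota X alpha (eval_at p (del i [seq extend v | v <- vs]))); first by ring.
  rewrite -sumrN; apply: eq_bigr => i _.
  rewrite /= /bump add1n add0n exprS /iota /del; ring.
- by move=> Ys; exact: smooth_form_eval sa.
- by apply: smooth_sections_cons => //; exact: smooth_extend.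
Qed.

End LieDerivative.

(** * Change of volume form *)

Lemma leib_scale (R : realType) (m : nat) (M : manifold R m) (r : nat)
    (A : lie_algebroid M r) (n : nat) (Pi : rmultisection A) (k : nat)
    (alpha beta : rform A) (g : M -> R) (p : M) (vs : seq (A p)) :
  nambu n Pi -> smooth_form n.-1 alpha -> smooth_form k beta -> smooth g ->
  leib n Pi alpha (fun q ws => g q * beta q ws) vs
  = g p * leib n Pi alpha beta vs + leib_action Pi alpha g p * beta p vs.
Proof.
move=> nPi sa sb sg; rewrite /leib (lieD_scale _ sg sb (smooth_sharp nPi sa)) /leib_action.
ring.
Qed.

Lemma modular_cocycle_change (R : realType) (m : nat) (M : manifold R m) (r : nat)
    (A : lie_algebroid M r) (n : nat) (Pi : rmultisection A) (g : M -> R)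
    (mu : rform A) (T T' : rmultisection A) (alpha : rform A) (p : M) :
    nambu n Pi -> smooth_form r mu -> nowhere_vanishing mu ->
    smooth g -> (forall q, g q != 0) ->
    modular_tensor n Pi mu T ->
    modular_tensor n Pi (fun q vs => g q * mu q vs) T' ->
    smooth_form n.-1 alpha ->
  pairing alpha T' p = pairing alpha T p + leib_action Pi alpha (log_abs g) p.
Proof.
move=> nPi smu mu0 sg g0 [_ hT] [_ hT'] sa; have [vs mup] := mu0 p.
rewrite /leib_action (derivation_log_abs sg g0 (anchor_tangent _)).
apply: (mulIf mup); apply: (mulfI (g0 p)).
have := hT' _ sa p vs; rewrite (leib_scale _ nPi sa smu sg) -hT// /leib_action => h.
by rewrite mulrCA h; have gp := g0 p; field.
Qed.

Theorem proposition4p8 (R : realType) (m : nat) (M : manifold R m) (r : nat)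
    (A : lie_algebroid M r) (hA : orientable A)
    (n : nat) (Pi : rmultisection A) (hPi : nambu n Pi)
    (mu mu' : rform A)
    (hmu : smooth_form r mu) (hmu0 : nowhere_vanishing mu)
    (hmu' : smooth_form r mu') (hmu0' : nowhere_vanishing mu')
    (Mmu Mmu' : rmultisection A)
    (hM : modular_tensor n Pi mu Mmu) (hM' : modular_tensor n Pi mu' Mmu') :
  leib_class Pi (contraction_cochain n Mmu)
  = leib_class Pi (contraction_cochain n Mmu').
Proof.
have [g [sg g0 mu'E]] := volume_ratio hmu hmu0 hmu' hmu0'.
have cE (alpha : form A n.-1) p : contraction_cochain n Mmu' alpha p
    = contraction_cochain n Mmu alpha p + coboundary Pi (log_abs g) alpha p.
  rewrite mu'E in hM'.
  exact: modular_cocycle_change hPi hmu hmu0 sg g0 hM hM' (svalP alpha).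
have sl := smooth_log_abs sg g0.
(* A cocycle in one class lies in the other with its potential f shifted by -ln |g| or +ln |g|. *)
apply/seteqP; split => z [cz [f sf zE]]; split => //.
  exists (fun q => f q - log_abs g q); first exact: smoothB sf sl.
  move=> alpha p; rewrite zE cE /coboundary /leib_action.
  by rewrite (derivationB (anchor_tangent _) sf sl); ring.
(* The factor 1 matches the linearity axiom of [tangent_vector]. *)
exists (fun q => 1 * f q + log_abs g q).
  exact: smoothD (smoothM (smooth_cst 1) sf) sl.
move=> alpha p; rewrite zE cE /coboundary /leib_action.
by have [-> // _] := anchor_tangent (sharp Pi (sval alpha) p); ring.
Qed.
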